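(* Let $n\ge 2$, let $\Omega\subset\mathbb{R}^n$ be a bounded domain and let $0\le\gamma<3$. Given a subdomain $\Omega'\Subset\Omega$, there exists a constant $\iota>0$, depending on $\|u\|_{L^\infty(\Omega)}$, $\gamma$ and $\Omega'$, such that for $u\in C(\Omega)$ a nonnegative, bounded viscosity solution to $\mathcal{L}^{\gamma}_\infty u=0$ in $\Omega$ there holds $$\frac{\mathscr{L}^n\big(B_r(X_0)\cap\{u>0\}\big)}{r^n}\ \ge\ \iota$$ for any $X_0\in\partial\{u>0\}\cap\Omega'$ and all sufficiently small $r>0$. In addition, there is a universal constant $0<\sigma_0\le 1$, depending only on $n$ and $\gamma$, such that the $(n-\sigma_0)$-dimensional Hausdorff measure of $\partial\{u>0\}$ is locally finite in $\Omega$.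
   Context: The infinity Laplacian is $\Delta_\infty u:=\sum_{i,j}\partial_i u\,\partial_{ij}u\,\partial_j u=(Du)^T D^2u\,Du$. Write $v^+=\max(v,0)$ and $\mathcal{L}^{\gamma}_\infty v:=\Delta_\infty v-(v^+)^\gamma$; for $\gamma=0$ the term $(v^+)^0$ is read as $1$ where $v>0$ and $0$ where $v\le 0$. A continuous function $u:\Omega\to\mathbb{R}$ is a viscosity subsolution of $\mathcal{L}^{\gamma}_\infty u=0$ in $\Omega$ (written $\mathcal{L}^\gamma_\infty u\ge 0$) if whenever $\varphi\in C^2$ and $u-\varphi$ has a local maximum at $Y\in\Omega$, then $\Delta_\infty\varphi(Y)-(u(Y)^+)^\gamma\ge 0$; it is a viscosity supersolution (written $\mathcal{L}^\gamma_\infty u\le 0$) if whenever $\varphi\in C^2$ and $\varphi-u$ has a local maximum at $Y\in\Omega$, then $\Delta_\infty\varphi(Y)-(u(Y)^+)^\gamma\le 0$. A viscosity solution is both. $\mathscr{L}^n$ is $n$-dimensional Lebesgue measure and $B_r(X_0)$ the open ball of radius $r$ centered at $X_0$. *)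

(* Defs.v *)
From mathcomp Require Import all_boot all_order all_algebra.
From mathcomp Require Import all_classical all_reals all_analysis.
Set Implicit Arguments.
Unset Strict Implicit.
Unset Printing Implicit Defensive.
Import Order.TTheory GRing.Theory Num.Theory.
Import numFieldNormedType.Exports.
Local Open Scope classical_set_scope.
Local Open Scope ring_scope.

(* Functions on a subset Omega of R^n are total functions on 'rV[R]_n of which
   only the values on Omega are used. *)

(* The canonical norm of 'rV[R]_n is the max norm: it has the right topology and
   the right bounded sets, but balls and diameters need the Euclidean norm. *)
Definition enorm (R : realType) (n : nat) (x : 'rV[R]_n) : R :=
  Num.sqrt (\sum_(i < n) x 0 i ^+ 2).

Definition eball (R : realType) (n : nat) (x0 : 'rV[R]_n) (r : R) :
  set 'rV[R]_n := [set x | enorm (x - x0) < r].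

Definition frontier (T : topologicalType) (A : set T) : set T :=
  closure A `\` interior A.

Definition domain (R : realType) (n : nat) (Omega : set 'rV[R]_n) : Prop :=
  [/\ open Omega, connected Omega & Omega !=set0].

Definition compactly_contained (T : topologicalType) (A B : set T) : Prop :=
  compact (closure A) /\ closure A `<=` B.

(* n-dimensional Lebesgue (outer) measure, from countable covers by boxes
   \prod_i [a_i, b_i]. *)
Definition closed_box (R : realType) (n : nat) (a b : 'rV[R]_n) :
  set 'rV[R]_n := [set x | forall i, a 0 i <= x 0 i <= b 0 i].

Definition lebesgue_rV (R : realType) (n : nat) (A : set 'rV[R]_n) : \bar R :=
  ereal_inf
    [set (\sum_(k <oo) (\prod_(i < n) ((ab k).2 0 i - (ab k).1 0 i))%:E)%E
      | ab in [set ab : nat -> 'rV[R]_n * 'rV[R]_n |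
          (forall k i, (ab k).1 0 i <= (ab k).2 0 i) /\
          A `<=` \bigcup_k closed_box (ab k).1 (ab k).2]].

(* Essential supremum of |u| over Omega. *)
Definition Linfty_norm (R : realType) (n : nat) (Omega : set 'rV[R]_n)
    (u : 'rV[R]_n -> R) : \bar R :=
  ereal_inf [set y%:E | y in [set y : R | 0 <= y /\
    lebesgue_rV [set x | Omega x /\ y < `|u x|] = 0%E]].

(* The ereal_sup of the empty set being -oo, diam set0 = -oo. *)
Definition diam (R : realType) (n : nat) (U : set 'rV[R]_n) : \bar R :=
  ereal_sup [set (enorm (p.1 - p.2))%:E | p in U `*` U].

Definition hausdorff_gauge (R : realType) (n : nat) (s : R)
    (U : set 'rV[R]_n) : \bar R :=
  if U == set0 then 0%E else poweR (diam U) s.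

Definition hausdorff_content (R : realType) (n : nat) (s delta : R)
    (A : set 'rV[R]_n) : \bar R :=
  ereal_inf
    [set (\sum_(k <oo) hausdorff_gauge s (U k))%E
      | U in [set U : nat -> set 'rV[R]_n |
          (forall k, (diam (U k) <= delta%:E)%E) /\ A `<=` \bigcup_k U k]].

(* Normalized without the factor 2^-s pi^(s/2) / Gamma(s/2 + 1), which is
   irrelevant for finiteness. *)
Definition hausdorff_measure (R : realType) (n : nat) (s : R)
    (A : set 'rV[R]_n) : \bar R :=
  ereal_sup [set hausdorff_content s delta A | delta in [set d : R | 0 < d]].

Definition partial (R : realType) (n : nat) (i : 'I_n) (f : 'rV[R]_n -> R) :
  'rV[R]_n -> R := fun x => 'D_(delta_mx 0 i) f x.

Definition C1 (R : realType) (n : nat) (Omega : set 'rV[R]_n)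
    (f : 'rV[R]_n -> R) : Prop :=
  forall x, Omega x -> {for x, continuous f} /\
    forall i, derivable f x (delta_mx 0 i) /\ {for x, continuous (partial i f)}.

Definition C2 (R : realType) (n : nat) (Omega : set 'rV[R]_n)
    (f : 'rV[R]_n -> R) : Prop :=
  C1 Omega f /\ forall i, C1 Omega (partial i f).

Definition infinity_laplacian (R : realType) (n : nat) (f : 'rV[R]_n -> R)
    (x : 'rV[R]_n) : R :=
  \sum_(i < n) \sum_(j < n)
    partial i f x * partial j (partial i f) x * partial j f x.

(* (v^+)^gamma; the case gamma = 0 is separate because 0 `^ 0 = 1. *)
Definition pos_power (R : realType) (gamma v : R) : R :=
  if gamma == 0 then (0 < v)%R%:R else Num.max v 0 `^ gamma.

Definition local_max (R : realType) (T : topologicalType) (f : T -> R) (y : T) :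
  Prop := \forall x \near y, f x <= f y.

Definition viscosity_subsolution (R : realType) (n : nat) (gamma : R)
    (Omega : set 'rV[R]_n) (u : 'rV[R]_n -> R) : Prop :=
  {within Omega, continuous u} /\
  forall (phi : 'rV[R]_n -> R) (y : 'rV[R]_n), C2 Omega phi -> Omega y ->
    local_max (fun x => u x - phi x) y ->
    infinity_laplacian phi y - pos_power gamma (u y) >= 0.

Definition viscosity_supersolution (R : realType) (n : nat) (gamma : R)
    (Omega : set 'rV[R]_n) (u : 'rV[R]_n -> R) : Prop :=
  {within Omega, continuous u} /\
  forall (phi : 'rV[R]_n -> R) (y : 'rV[R]_n), C2 Omega phi -> Omega y ->
    local_max (fun x => phi x - u x) y ->
    infinity_laplacian phi y - pos_power gamma (u y) <= 0.

Definition viscosity_solution (R : realType) (n : nat) (gamma : R)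
    (Omega : set 'rV[R]_n) (u : 'rV[R]_n -> R) : Prop :=
  viscosity_subsolution gamma Omega u /\ viscosity_supersolution gamma Omega u.

Definition nonneg_bounded_solution (R : realType) (n : nat) (gamma : R)
    (Omega : set 'rV[R]_n) (u : 'rV[R]_n -> R) : Prop :=
  [/\ {within Omega, continuous u}, (forall x, Omega x -> 0 <= u x),
      [bounded u x | x in Omega] & viscosity_solution gamma Omega u].

Definition positivity_set (R : realType) (n : nat) (Omega : set 'rV[R]_n)
  (u : 'rV[R]_n -> R) : set 'rV[R]_n := [set x | Omega x /\ 0 < u x].

(* Main.v *)
(** The set [{u > 0}] is uniformly porous at its boundary, by comparison with
    explicit barriers. If [u Y = m] with [m ^ (3 - gamma)] large against [D ^ 4],
    a strictly convex radial profile with a cone singularity at [Y] lies below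
    the supersolution [u] on the ball of radius [D], so [u > 0] on the ball of
    radius [D / 2]. If [u Y > 0] and [m ^ (3 - gamma)] is small against [r ^ 4],
    then [u] reaches [m] in the ball of radius [r]: otherwise [u] minus the strict
    supersolution [m * (|x - Y| / r) ^ (2 k)], [k] large, would be positive at [Y]
    and negative on the sphere, hence maximal at an interior point, which is
    impossible. Hence every ball centred on the free boundary contains a ball of
    comparable radius where [u > 0], which gives the density bound. In an
    [N]-adic subdivision at least one of the [N ^ n] subcubes of each cube misses
    the free boundary, so it is covered by [C * (N ^ n - 1) ^ j] cubes of side
    [l / N ^ j], and the exponent [ln (N ^ n - 1) / ln N < n] works. *)

Require Import Defs.
From mathcomp Require Import all_boot all_order all_algebra.
From mathcomp Require Import all_classical all_reals all_analysis.
From mathcomp Require Import ring lra.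
Import Order.TTheory GRing.Theory Num.Theory.
Import numFieldNormedType.Exports.
Local Open Scope classical_set_scope.
Local Open Scope ring_scope.

Set Implicit Arguments.
Unset Strict Implicit.
Unset Printing Implicit Defensive.

(** * Radial test functions *)

(** The squared distance is polynomial in the coordinates, so a polynomial in it is smooth
    everywhere, the centre included; every test function below has this form. *)
Definition sqdist (R : realType) (n : nat) (c x : 'rV[R]_n) : R :=
  \sum_(i < n) (x 0 i - c 0 i) ^+ 2.

Lemma is_derive_coord (R : realType) (n : nat) (i : 'I_n) (x v : 'rV[R]_n) :
  is_derive x v (fun y : 'rV[R]_n => y 0 i) (v 0 i).
Proof.
have quo (h : R) : h != 0 ->
    h^-1 *: (((fun y : 'rV[R]_n => y 0 i) \o shift x) (h *: v) - x 0 i) = v 0 i.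
  move=> h0; rewrite /= !mxE addrK.
  by rewrite /GRing.scale /= mulrA mulVf// mul1r.
have lim : (h^-1 *: (((fun y : 'rV[R]_n => y 0 i) \o shift x) (h *: v) - x 0 i))
    @[h --> 0^'] --> v 0 i.
  apply: (@cvg_trans _ ((cst (v 0 i) : R -> R) h @[h --> 0^'])); last exact: cvg_cst.
  apply: near_eq_cvg; near=> h; rewrite quo//; near: h; exact: nbhs_dnbhs_neq.
apply: DeriveDef; first by apply/cvg_ex; exists (v 0 i).
exact/cvg_lim.
Unshelve. all: by end_near. Qed.

Lemma is_derive_sqdist (R : realType) (n : nat) (i : 'I_n) (c x : 'rV[R]_n) :
  is_derive x (delta_mx 0 i) (sqdist c) (2 * (x 0 i - c 0 i)).
Proof.
have -> : sqdist c =
    \sum_(j < n) (fun y : 'rV[R]_n => (y 0 j - c 0 j) ^+ 2).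
  by apply/funext => y; rewrite fct_sumE.
apply: (@is_derive_eq _ _ _ _ _ _ _
  (\sum_(j < n) 2 * (x 0 j - c 0 j) * (delta_mx 0 i : 'rV[R]_n) 0 j)); last first.
  rewrite (bigD1 i)//= big1 => [|j ji]; rewrite !mxE ?eqxx ?mulr1 ?addr0//.
  by rewrite (negbTE ji) mulr0.
apply: is_derive_sum => j.
have H := is_deriveB (is_derive_coord j x (delta_mx 0 i))
  (is_derive_cst (c 0 j) x (delta_mx 0 i)).
have -> : (fun y : 'rV[R]_n => (y 0 j - c 0 j) ^+ 2) =
    ((fun y : 'rV[R]_n => y 0 j) - cst (c 0 j)) * ((fun y : 'rV[R]_n => y 0 j) - cst (c 0 j)).
  by apply/funext => y; rewrite expr2.
apply: (is_derive_eq (is_deriveM H H)).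
rewrite /GRing.scale /= subr0.
have -> : ((fun y : 'rV[R]_n => y 0 j) - cst (c 0 j)) x = x 0 j - c 0 j by [].
ring.
Qed.

Lemma is_derive_horner_comp (R : realType) (V : normedModType R) (q : {poly R})
    (f : V -> R) (x v : V) (df : R) :
  is_derive x v f df ->
  is_derive x v (fun y => q.[f y]) (q^`().[f x] * df).
Proof.
move=> Hf; elim/poly_ind: q => [|q a IH].
  have -> : (fun y => (0 : {poly R}).[f y]) = cst 0.
    by apply/funext => y; rewrite horner0.
  by rewrite deriv0 horner0 mul0r; exact: is_derive_cst.
have -> : (fun y => (q * 'X + a%:P).[f y]) = (fun y => q.[f y]) * f + cst a.
  by apply/funext => y; rewrite hornerMXaddC.
apply: (is_derive_eq (is_deriveD (is_deriveM IH Hf) (is_derive_cst a x v))).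
rewrite addr0 derivD derivM derivX derivC !hornerE /GRing.scale /=; ring.
Qed.

Section radial.
Context (R : realType) (n : nat) (c : 'rV[R]_n) (q : {poly R}).

Let phi (x : 'rV[R]_n) := q.[sqdist c x].

Lemma is_derive_radial (i : 'I_n) (x : 'rV[R]_n) :
  is_derive x (delta_mx 0 i) phi (q^`().[sqdist c x] * (2 * (x 0 i - c 0 i))).
Proof. exact/is_derive_horner_comp/is_derive_sqdist. Qed.

Lemma partial_radial (i : 'I_n) : partial i phi =
  fun x => q^`().[sqdist c x] * (2 * (x 0 i - c 0 i)).
Proof. by apply/funext => x; apply: derive_val; exact: is_derive_radial. Qed.

End radial.

Section radial2.
Context (R : realType) (n : nat) (c : 'rV[R]_n).

Lemma is_derive_partial_radial (q : {poly R}) (i j : 'I_n) (x : 'rV[R]_n) :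
  is_derive x (delta_mx 0 j)
    (fun x => q.[sqdist c x] * (2 * (x 0 i - c 0 i)))
    (q^`().[sqdist c x] * (2 * (x 0 j - c 0 j)) * (2 * (x 0 i - c 0 i)) +
     q.[sqdist c x] * (2 * (i == j)%:R)).
Proof.
have H := is_deriveB (is_derive_coord i x (delta_mx 0 j))
  (is_derive_cst (c 0 i) x (delta_mx 0 j)).
have H2 := is_deriveM (is_derive_horner_comp q (is_derive_sqdist j c x))
   (is_deriveM (is_derive_cst (2 : R) x (delta_mx 0 j)) H).
apply: (is_derive_eq H2).
rewrite !mxE /= /GRing.scale /= subr0 mulr0 addr0 addrC [_ * (_ * _)]mulrC.
by congr (_ + _); rewrite mulrC.
Qed.

Lemma continuous_coordB (i : 'I_n) :
  continuous (fun y : 'rV[R]_n => y 0 i - c 0 i : R).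
Proof.
move=> x; exact: (continuousB (@coord_continuous R 1 n 0 i x) (@cst_continuous _ _ (c 0 i) x)).
Qed.

Lemma continuous_sqdist : continuous (sqdist c).
Proof.
rewrite /sqdist; apply: continuous_big => [|i _ x]; first exact: add_continuous.
exact: (continuousM (@continuous_coordB i x) (@continuous_coordB i x)).
Qed.

Lemma continuous_horner_sqdist (q : {poly R}) :
  continuous (fun x => q.[sqdist c x]).
Proof.
move=> x; apply: (@continuous_comp _ _ _ (sqdist c) (horner q)).
  exact: continuous_sqdist.
exact: continuous_horner.
Qed.

Lemma continuous_partial_radial (q : {poly R}) (i : 'I_n) :
  continuous (fun x => q.[sqdist c x] * (2 * (x 0 i - c 0 i))).
Proof.
move=> x; exact: (continuousM (@continuous_horner_sqdist q x)
  (continuousM (@cst_continuous _ _ (2 : R) x) (@continuous_coordB i x))).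
Qed.

Lemma C2_radial (Omega : set 'rV[R]_n) (q : {poly R}) :
  C2 Omega (fun x => q.[sqdist c x]).
Proof.
split => [x _|i x _].
  split => [|i]; first exact: continuous_horner_sqdist.
  split; first exact: (@ex_derive _ _ _ _ _ _ _ (is_derive_radial c q i x)).
  by rewrite partial_radial; exact: continuous_partial_radial.
rewrite partial_radial; split => [|j]; first exact: continuous_partial_radial.
split; first exact: (@ex_derive _ _ _ _ _ _ _ (is_derive_partial_radial _ i j x)).
have -> : partial j (fun x => q^`().[sqdist c x] * (2 * (x 0 i - c 0 i))) =
  fun x => q^`()^`().[sqdist c x] * (2 * (x 0 j - c 0 j)) * (2 * (x 0 i - c 0 i)) +
     q^`().[sqdist c x] * (2 * (i == j)%:R).
  by apply/funext => z; apply: derive_val; exact: is_derive_partial_radial.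
exact: (continuousD
  (continuousM (@continuous_partial_radial _ j x)
    (continuousM (@cst_continuous _ _ (2 : R) x) (@continuous_coordB i x)))
  (continuousM (@continuous_horner_sqdist _ x) (@cst_continuous _ _ _ x))).
Qed.

(** With [d = x - c], the gradient is [2 a d] and the Hessian [4 b d d^T + 2 a I], where [a] and [b]
    are the first two derivatives of [q] at [s = |d|^2]. *)
Lemma infinity_laplacian_radial (q : {poly R}) (x : 'rV[R]_n) :
  let s := sqdist c x in
  infinity_laplacian (fun x => q.[sqdist c x]) x =
  8 * q^`().[s] ^+ 3 * s + 16 * q^`().[s] ^+ 2 * q^`()^`().[s] * s ^+ 2.
Proof.
move=> s; rewrite /infinity_laplacian.
set a := q^`().[s]; set b := q^`()^`().[s].
transitivity (\sum_(i < n) (8 * a ^+ 3 * (x 0 i - c 0 i) ^+ 2 +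
    16 * a ^+ 2 * b * s * (x 0 i - c 0 i) ^+ 2)); last first.
  by rewrite big_split/= -!mulr_sumr -/(sqdist c x) -/s; ring.
apply: eq_bigr => i _.
transitivity (\sum_(j < n) (8 * a ^+ 3 * (x 0 i - c 0 i) * ((i == j)%:R * (x 0 j - c 0 j)) +
    16 * a ^+ 2 * b * (x 0 i - c 0 i) ^+ 2 * (x 0 j - c 0 j) ^+ 2)); last first.
  rewrite big_split/= -!mulr_sumr -/(sqdist c x) -/s (bigD1 i)//= big1 => [|j ji].
    by rewrite eqxx mul1r addr0; ring.
  by rewrite eq_sym (negbTE ji) mul0r.
apply: eq_bigr => j _.
have -> : partial j (partial i (fun x => q.[sqdist c x])) x =
    b * (2 * (x 0 j - c 0 j)) * (2 * (x 0 i - c 0 i)) + a * (2 * (i == j)%:R).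
  rewrite partial_radial; apply: derive_val; exact: is_derive_partial_radial.
by rewrite !partial_radial -/s -/a; ring.
Qed.

End radial2.

(** * Growth and nondegeneracy *)

Lemma sqdist_ge0 (R : realType) (n : nat) (c x : 'rV[R]_n) : 0 <= sqdist c x.
Proof. by apply: sumr_ge0 => i _; exact: sqr_ge0. Qed.

Lemma sqdistxx (R : realType) (n : nat) (c : 'rV[R]_n) : sqdist c c = 0.
Proof. by rewrite /sqdist big1// => i _; rewrite subrr expr0n. Qed.

Lemma normv_coord (R : realType) (n : nat) (x : 'rV[R]_n) (i : 'I_n) :
  `|x 0 i| <= `|x|.
Proof.
rewrite [X in _ <= X]mx_normrE.
exact: (le_bigmax _ (fun ij : 'I_1 * 'I_n => `|x ij.1 ij.2|) (0, i)).
Qed.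

Lemma normv_le (R : realType) (n : nat) (x : 'rV[R]_n) (r : R) :
  0 <= r -> (forall i, `|x 0 i| <= r) -> `|x| <= r.
Proof.
move=> r0 H; rewrite [X in X <= _]mx_normrE; apply/bigmax_leP; split => // -[i j] _ /=.
by rewrite (ord1 i).
Qed.

Lemma norm_le_of_sqdist (R : realType) (n : nat) (c x : 'rV[R]_n) (r : R) :
  0 <= r -> sqdist c x <= r ^+ 2 -> `|x - c| <= r.
Proof.
move=> r0 H; apply: normv_le => // i; rewrite !mxE.
rewrite -(ler_pXn2r (_ : (0 < 2)%N)) ?nnegrE// real_normK ?num_real//.
apply: le_trans H; rewrite /sqdist (bigD1 i)//= lerDl.
by apply: sumr_ge0 => j _; exact: sqr_ge0.
Qed.

(** The sharp factor is the square root of [n]; the cruder [n] keeps the bound free of roots. *)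
Lemma sqdist_le_of_norm (R : realType) (n : nat) (c x : 'rV[R]_n) (r : R) :
  `|x - c| <= r -> sqdist c x <= (n%:R * r) ^+ 2.
Proof.
move=> H; have r0 : 0 <= r by exact: le_trans H.
have [n0|n0] := posnP n.
  by rewrite /sqdist big1 ?sqr_ge0// => i; have := ltn_ord i; rewrite [X in (_ < X)%N]n0.
apply: (@le_trans _ _ (\sum_(i < n) r ^+ 2)).
  apply: ler_sum => i _; rewrite -[leLHS]real_normK ?num_real// lerXn2r ?nnegrE//.
  by apply: le_trans H; have := normv_coord (x - c) i; rewrite !mxE.
rewrite sumr_const card_ord exprMn -[leLHS]mulr_natl. apply: ler_wpM2r; first exact: sqr_ge0.
by rewrite expr2 ler_peMl ?ler0n// ler1n.
Qed.

Lemma compact_sqball (R : realType) (n : nat) (c : 'rV[R]_n) (r : R) :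
  0 <= r -> compact [set x | sqdist c x <= r ^+ 2].
Proof.
move=> r0; apply: bounded_closed_compact.
  exists (r + `|c|); split; first exact: num_real.
  move=> M /ltW rM x /= /(norm_le_of_sqdist r0) H; apply: le_trans rM.
  by rewrite -[x](subrK c); apply: le_trans (ler_normD _ _) _; rewrite lerD2r.
apply: (@closed_comp _ _ (sqdist c) [set t : R | t <= r ^+ 2]).
  by move=> x _; exact: continuous_sqdist.
exact: closed_le.
Qed.

Lemma sqball_max (R : realType) (n : nat) (c : 'rV[R]_n) (r : R)
    (f : 'rV[R]_n -> R) : 0 <= r ->
  (forall x, sqdist c x <= r ^+ 2 -> {for x, continuous f}) ->
  exists2 y, sqdist c y <= r ^+ 2 &
    forall x, sqdist c x <= r ^+ 2 -> f x <= f y.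
Proof.
move=> r0 cf; have [|||y yr ymax] := @EVT_max_rV R n f [set x | sqdist c x <= r ^+ 2].
- by exists c; rewrite /= sqdistxx sqr_ge0.
- exact: compact_sqball.
- by apply: continuous_in_subspaceT => x; rewrite inE /=; exact: cf.
by rewrite inE in yr; exists y => // x xr; apply: ymax; rewrite inE.
Qed.

Lemma near_sqball (R : realType) (n : nat) (c y : 'rV[R]_n) (r : R) :
  sqdist c y < r -> \forall x \near y, sqdist c x < r.
Proof.
by move=> yr; have /cvgr_lt := @continuous_sqdist _ _ c y; apply.
Qed.

Lemma deriv_scaled_pow (R : realType) (m l : R) (n : nat) :
  (m *: (l *: 'X) ^+ n)^`() = (m * (n%:R * l)) *: (l *: 'X) ^+ n.-1.
Proof.
rewrite derivZ deriv_exp derivZ derivX -[l *: 1]/(l%:A) mulr_algl.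
by rewrite -scaler_nat !scalerA mulrA.
Qed.

Section pos_power.
Context (R : realType) (gamma : R).
Hypothesis gamma0 : 0 <= gamma.

(** For [gamma = 0] the power of [m] is 1 even at [m = 0]: it dominates both values of the
    indicator, but bounds it from below only where [v > 0], hence the positivity hypothesis of
    [pos_power_ge]. *)
Lemma pos_power_le (m v : R) : 0 <= m -> v <= m -> pos_power gamma v <= m `^ gamma.
Proof.
move=> m0 vm; rewrite /pos_power; case: eqP => [->|_].
  by rewrite powRr0; case: (0 < v); rewrite ?lexx ?ler01.
apply: ge0_ler_powR => //; rewrite ?nnegrE ?le_max ?lexx ?orbT//.
by rewrite ge_max vm.
Qed.

Lemma pos_power_ge (m v : R) :
  0 <= m -> 0 < v -> m <= v -> m `^ gamma <= pos_power gamma v.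
Proof.
move=> m0 v0 vm; rewrite /pos_power; case: eqP => [->|_].
  by rewrite powRr0 v0.
apply: ge0_ler_powR => //; rewrite ?nnegrE ?le_max ?lexx ?orbT//.
by rewrite vm.
Qed.

Lemma pos_power_gt0 (v : R) : 0 < v -> 0 < pos_power gamma v.
Proof.
move=> v0; rewrite /pos_power; case: eqP => _; first by rewrite v0.
by apply: powR_gt0; rewrite lt_max v0.
Qed.

End pos_power.

Lemma continuous_of_within (R : realType) (n : nat) (Omega : set 'rV[R]_n)
    (u : 'rV[R]_n -> R) :
  open Omega -> {within Omega, continuous u} ->
  forall x, Omega x -> {for x, continuous u}.
Proof.
move=> oO; rewrite (continuous_open_subspace _ oO) => H x Ox.
by apply: H; rewrite inE.
Qed.

(* The right-hand side is [b] times the second-order Taylor expansion of the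
   square root at [rho0 ^ 2], plus an error term. *)
Lemma sqrt_le_quadratic (R : realType) (b e rho0 : R) :
  0 < b -> 0 < e -> 0 < rho0 ->
  exists2 delta : R, 0 < delta & forall rho, 0 <= rho -> `|rho - rho0| < delta ->
    b * rho <= b * (rho0 + (rho ^+ 2 - rho0 ^+ 2) / (2 * rho0)
                 - (rho ^+ 2 - rho0 ^+ 2) ^+ 2 / (8 * rho0 ^+ 3))
               + e * (rho ^+ 2 - rho0 ^+ 2) ^+ 2.
Proof.
(* For [t = rho - rho0], the first bound gives [2 * rho0 + t >= rho0]; the second gives
   [b * |t| / rho0 ^ 2 <= e * rho0 ^ 2]. *)
move=> b0 e0 r0; exists (Num.min rho0 (e * rho0 ^+ 4 / b)).
  by rewrite lt_min r0 divr_gt0// mulr_gt0// exprn_gt0.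
move=> rho rho_ge0; rewrite lt_min => /andP[t1 t2].
set t := rho - rho0 in t1 t2; have -> : rho = rho0 + t by rewrite /t; ring.
rewrite -subr_ge0.
(* The Taylor remainder starts at order [t ^ 3], while the error term is of order [t ^ 2]. *)
have -> : b * (rho0 + ((rho0 + t) ^+ 2 - rho0 ^+ 2) / (2 * rho0)
                 - ((rho0 + t) ^+ 2 - rho0 ^+ 2) ^+ 2 / (8 * rho0 ^+ 3))
               + e * ((rho0 + t) ^+ 2 - rho0 ^+ 2) ^+ 2 - b * (rho0 + t) =
   t ^+ 2 * (e * (2 * rho0 + t) ^+ 2 - b * (t / (2 * rho0 ^+ 2) + t ^+ 2 / (8 * rho0 ^+ 3))).
  by field; rewrite gt_eqF.
rewrite mulr_ge0 ?sqr_ge0// subr_ge0.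
have ht : t <= `|t| by exact: ler_norm.
have ht2 : t ^+ 2 <= `|t| * rho0.
  by rewrite -real_normK ?num_real// expr2 ler_wpM2l// ltW.
have H1 : t / (2 * rho0 ^+ 2) + t ^+ 2 / (8 * rho0 ^+ 3) <= `|t| / rho0 ^+ 2.
  apply: (@le_trans _ _ (`|t| / (2 * rho0 ^+ 2) + `|t| * rho0 / (8 * rho0 ^+ 3))).
    by apply: lerD; rewrite ler_pM2r ?invr_gt0 ?mulr_gt0 ?exprn_gt0.
  have -> : `|t| / (2 * rho0 ^+ 2) + `|t| * rho0 / (8 * rho0 ^+ 3) = 5 / 8 * (`|t| / rho0 ^+ 2).
    by field; rewrite gt_eqF.
  have : 0 <= `|t| / rho0 ^+ 2 by rewrite divr_ge0// exprn_ge0// ltW.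
  lra.
apply: (@le_trans _ _ (b * (`|t| / rho0 ^+ 2))); first by rewrite ler_pM2l.
apply: (@le_trans _ _ (e * rho0 ^+ 2)).
  rewrite mulrA ler_pdivrMr ?exprn_gt0// -mulrA -exprD.
  by rewrite mulrC -ler_pdivlMr// ltW.
rewrite ler_pM2l// lerXn2r ?nnegrE ?ltW//.
  by have := ler_norm (- t); rewrite normrN; lra.
by have := ler_norm (- t); rewrite normrN; lra.
Qed.

Section pde.
Context (R : realType) (n : nat) (gamma : R) (Omega : set 'rV[R]_n)
  (u : 'rV[R]_n -> R).
Hypotheses (gamma0 : 0 <= gamma) (openO : open Omega).

(** The test function is expanded around [s], so that [a1] and [2 * a2] are the two derivatives
    entering [infinity_laplacian_radial]. *)
Lemma supersolution_quadratic_test (c y : 'rV[R]_n) (a0 a1 a2 : R) :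
  viscosity_supersolution gamma Omega u -> Omega y ->
  let s := sqdist c y in
  local_max (fun x => a0 + a1 * (sqdist c x - s) + a2 * (sqdist c x - s) ^+ 2 - u x) y ->
  8 * a1 ^+ 3 * s + 32 * a1 ^+ 2 * a2 * s ^+ 2 <= pos_power gamma (u y).
Proof.
move=> [_ Hu] Oy s Hmax.
pose q : {poly R} := a0%:P + a1 *: ('X - s%:P) + a2 *: ('X - s%:P) ^+ 2.
have qE t : q.[t] = a0 + a1 * (t - s) + a2 * (t - s) ^+ 2 by rewrite /q !hornerE.
have q1 : q^`().[s] = a1.
  by rewrite /q !poly.derivE !hornerE subrr /= add0r subrr mulr0 addr0.
have q2 : q^`()^`().[s] = 2 * a2.
  rewrite /q !poly.derivE !hornerE /=; ring.
have := Hu (fun x => q.[sqdist c x]) y (C2_radial c Omega q) Oy.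
rewrite infinity_laplacian_radial -/s q1 q2 subr_le0 => H.
have -> : 32 * a1 ^+ 2 * a2 * s ^+ 2 = 16 * a1 ^+ 2 * (2 * a2) * s ^+ 2 by ring.
by apply: H; apply: filterS Hmax => x; rewrite !qE.
Qed.

(** The profile is [h = m (1 - t) (2 - t) / 2] with [t = rho / D]: it falls from [m] to 0 on the
    ball of radius [D], and [h'^2 h'' = m^3 (3 - 2 t)^2 / (4 D^4)]. A zero of [u] in the half ball
    would give [w - u] a positive maximum, away from the centre and the sphere. The factor 8 in the
    hypothesis, instead of 4, leaves room to halve [h'']. *)
Lemma supersolution_growth (Y z : 'rV[R]_n) (D : R) :
  viscosity_supersolution gamma Omega u -> (forall x, Omega x -> 0 <= u x) ->
  0 < D -> (forall x, sqdist Y x <= D ^+ 2 -> Omega x) ->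
  0 < u Y -> 8 * D ^+ 4 * u Y `^ gamma < u Y ^+ 3 ->
  sqdist Y z <= (D / 2) ^+ 2 -> 0 < u z.
Proof.
move=> su u0 D0 DO; set m := u Y => m0 mD zD; rewrite ltNge; apply/negP => uz0.
(* [h (|x - Y|)] is not smooth at [Y], but there it equals [u]. *)
pose h (rho : R) := m * (1 - 3 / 2 * (rho / D) + (rho / D) ^+ 2 / 2).
pose w x := h (Num.sqrt (sqdist Y x)).
have cw : continuous w.
  move=> x; apply: (@continuous_comp _ _ _ (fun x => Num.sqrt (sqdist Y x)) h).
    apply: continuous_comp; first exact: continuous_sqdist.
    exact: sqrt_continuous.
  pose p : {poly R} := m *: (1 - (3 / 2 / D) *: 'X + (D ^- 2 / 2) *: 'X^2).
  have -> : h = horner p.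
    apply/funext => t; rewrite /h /p !hornerE /=; field; exact: lt0r_neq0.
  exact: continuous_horner.
have cu := continuous_of_within openO su.1.
have [y yD ymax] : exists2 y, sqdist Y y <= D ^+ 2 &
    forall x, sqdist Y x <= D ^+ 2 -> w x - u x <= w y - u y.
  apply: (@sqball_max _ _ _ _ (fun x => w x - u x)); first exact: ltW.
  by move=> x /DO /cu cux; exact: (continuousB (cw x) cux).
set rho0 := Num.sqrt (sqdist Y y).
have s0E : sqdist Y y = rho0 ^+ 2 by rewrite sqr_sqrtr// sqdist_ge0.
have rho0_ge0 : 0 <= rho0 by exact: sqrtr_ge0.
have rho0D : rho0 <= D by rewrite -(ler_pXn2r (_ : (0 < 2)%N)) ?nnegrE// -?s0E// ltW.
have wuy : 0 < w y - u y.
  apply: lt_le_trans (ymax z _); last first.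
    by apply: (le_trans zD); rewrite ler_pXn2r ?nnegrE//; lra.
  rewrite subr_gt0; apply: (le_lt_trans uz0).
  rewrite /w; set t := Num.sqrt _.
  have t0 : 0 <= t by exact: sqrtr_ge0.
  have tD : t <= D / 2.
    rewrite -(ler_pXn2r (_ : (0 < 2)%N)) ?nnegrE//; last lra.
    by rewrite sqr_sqrtr// sqdist_ge0.
  rewrite /h mulr_gt0//.
  have : t / D <= 1 / 2 by rewrite ler_pdivrMr//; lra.
  have : 0 <= t / D by rewrite divr_ge0// ltW.
  by nra.
have rho00 : 0 < rho0.
  rewrite lt_neqAle rho0_ge0 andbT; apply/negP => /eqP r0.
  have yY : y = Y.
    apply/eqP; rewrite -subr_eq0 -normr_le0.
    by apply: norm_le_of_sqdist => //; rewrite s0E -r0 expr0n.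
  move: wuy; rewrite /w -/rho0 -r0 /h yY -/m mul0r; lra.
have rho0ltD : rho0 < D.
  rewrite lt_neqAle rho0D andbT; apply/negP => /eqP r0.
  have /DO/u0 uy := yD.
  move: wuy; rewrite /w -/rho0 r0 /h divff ?gt_eqF//; nra.
have Oy : Omega y by exact: DO.
pose b := 3 * m / (2 * D).
(* The error [e] spends half of [h''], so the test function stays strictly
   infinity-subharmonic. *)
pose e := m / (16 * D ^+ 2 * rho0 ^+ 2).
have b0 : 0 < b by rewrite /b; apply: divr_gt0; lra.
have e0 : 0 < e by rewrite /e; apply: divr_gt0 => //; rewrite !mulr_gt0 ?exprn_gt0.
(* As [h rho = m - b * rho + m * rho ^ 2 / (2 * D ^ 2)], only the term [- b * rho] is not polynomial
   in the squared distance; it is replaced by its quadratic lower bound. *)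
have [delta d0 Hd] := sqrt_le_quadratic b0 e0 rho00.
have := @supersolution_quadratic_test Y y (w y) (- b / (2 * rho0) + m / (2 * D ^+ 2))
  (b / (8 * rho0 ^+ 3) - e) su Oy.
rewrite /= s0E => /(_ _)/wrap[].
  have n1 : \forall x \near y, `|Num.sqrt (sqdist Y x) - rho0| < delta.
    have : Num.sqrt (sqdist Y x) @[x --> y] --> rho0.
      apply: (@continuous_comp _ _ _ (sqdist Y) Num.sqrt); first exact: continuous_sqdist.
      exact: sqrt_continuous.
    by move/cvgr_dist_lt => /(_ _ d0); apply: filterS => x; rewrite distrC.
  have n2 : \forall x \near y, sqdist Y x < D ^+ 2.
    by apply: near_sqball; rewrite s0E ltr_pXn2r ?nnegrE// ltW.
  rewrite /local_max; near=> x.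
  have x1 : `|Num.sqrt (sqdist Y x) - rho0| < delta by near: x.
  have x2 : sqdist Y x < D ^+ 2 by near: x.
  have := ymax x (ltW x2); set t := Num.sqrt (sqdist Y x) in x1 *.
  have t0 : 0 <= t by exact: sqrtr_ge0.
  have sE : sqdist Y x = t ^+ 2 by rewrite sqr_sqrtr// sqdist_ge0.
  rewrite sE s0E subrr mulr0 expr0n mulr0 !addr0.
  apply: le_trans; rewrite lerD2r {2}/w sE -/t.
  have := Hd _ t0 x1.
  rewrite /w -/rho0 /h -subr_ge0 => H; rewrite -subr_ge0; apply: le_trans H _.
  rewrite le_eqVlt; apply/orP; left; apply/eqP.
  by rewrite /b /e sqrtr_sqr ger0_norm//; field; rewrite !gt_eqF.
(* This is [h'^2 h'' / 2] at [rho0]; its last factor is at least 1 because [rho0 <= D]. *)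
have -> : 8 * (- b / (2 * rho0) + m / (2 * D ^+ 2)) ^+ 3 * rho0 ^+ 2 +
    32 * (- b / (2 * rho0) + m / (2 * D ^+ 2)) ^+ 2 *
     (b / (8 * rho0 ^+ 3) - e) * (rho0 ^+ 2) ^+ 2 =
    m ^+ 3 / (8 * D ^+ 4) * (3 - 2 * (rho0 / D)) ^+ 2.
  by rewrite /b /e; field; rewrite !gt_eqF.
have : pos_power gamma (u y) <= m `^ gamma.
  apply: pos_power_le => //; first exact: ltW.
  move: wuy; rewrite subr_gt0 => /ltW /le_trans; apply.
  rewrite /w -/rho0 /h ler_piMr//; first exact: ltW.
  have : rho0 / D <= 1 by rewrite ler_pdivrMr// mul1r.
  have : 0 <= rho0 / D by rewrite divr_ge0// ltW.
  by nra.
move=> /[swap] /le_trans /[apply] H.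
have : m ^+ 3 / (8 * D ^+ 4) <= m `^ gamma.
  apply: le_trans H; rewrite ler_peMr//.
    by rewrite divr_ge0// ?mulr_ge0// ?exprn_ge0// ltW.
  have : rho0 / D <= 1 by rewrite ler_pdivrMr// mul1r.
  by nra.
rewrite ler_pdivrMr ?mulr_gt0 ?exprn_gt0// mulrC => H'.
by have := lt_le_trans mD H'; rewrite ltxx.
Unshelve. all: by end_near. Qed.

(** With [K = k.+2] and [tau = |x - Y|^2 / r^2], the barrier [m tau^K] has infinity Laplacian
    proportional to [m^3 tau^(3 K - 2) / r^4], whereas [u^gamma >= m^gamma tau^(K gamma)] where [u]
    exceeds it. Since [tau <= 1] and [K gamma <= 3 K - 2], the powers of [tau] compare in the right
    direction. *)
Lemma subsolution_nondegenerate (Y : 'rV[R]_n) (r m : R) (k : nat) :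
  viscosity_subsolution gamma Omega u ->
  0 < r -> (forall x, sqdist Y x <= r ^+ 2 -> Omega x) ->
  0 < u Y -> 0 < m -> k.+2%:R * gamma <= (3 * k.+2 - 2)%:R ->
  8 * k.+2%:R ^+ 3 * (2 * k.+2%:R - 1) * m ^+ 3 < r ^+ 4 * m `^ gamma ->
  exists2 x, sqdist Y x <= r ^+ 2 & m <= u x.
Proof.
set K := k.+2 => su r0 rO uY m0 Kg mr.
apply: contrapT => /forall2NP noX.
have um x : sqdist Y x <= r ^+ 2 -> u x < m.
  by move=> xr; have [//|/negP] := noX x; rewrite -ltNge.
pose q : {poly R} := m *: ((r ^- 2) *: 'X) ^+ K.
have cu := continuous_of_within openO su.1.
have [y yr ymax] : exists2 y, sqdist Y y <= r ^+ 2 &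
    forall x, sqdist Y x <= r ^+ 2 -> u x - q.[sqdist Y x] <= u y - q.[sqdist Y y].
  apply: (@sqball_max _ _ _ _ (fun x => u x - q.[sqdist Y x])); first exact: ltW.
  by move=> x /rO /cu cux; exact: (continuousB cux (@continuous_horner_sqdist _ _ Y q x)).
have Oy := rO _ yr.
set s := sqdist Y y in yr ymax; pose tau := s / r ^+ 2.
have sE : s = r ^+ 2 * tau by rewrite /tau mulrC divfK// gt_eqF// exprn_gt0.
have qE t : q.[t] = m * (t / r ^+ 2) ^+ K.
  by rewrite /q hornerZ horner_exp hornerZ hornerX [r ^- 2 * _]mulrC.
have uqy : 0 < u y - q.[s].
  apply: lt_le_trans (ymax Y _); last by rewrite sqdistxx sqr_ge0.
  by rewrite sqdistxx qE mul0r expr0n mulr0 subr0.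
have tau0 : 0 <= tau by rewrite divr_ge0 ?sqdist_ge0 ?sqr_ge0.
have tau1 : tau < 1.
  rewrite ltr_pdivrMr ?exprn_gt0// mul1r lt_neqAle yr andbT; apply/negP => /eqP sr.
  move: uqy; rewrite sr qE divff ?gt_eqF ?exprn_gt0// expr1n mulr1 subr_gt0.
  by rewrite ltNge (ltW (um _ _))// -sr.
have uy0 : 0 < u y.
  move: uqy; rewrite subr_gt0; apply: le_lt_trans.
  by rewrite qE mulr_ge0 ?exprn_ge0// ltW.
have := su.2 (fun x => q.[sqdist Y x]) y (C2_radial Y Omega q) Oy.
have q1 : q^`().[s] = m * (K%:R * r ^- 2) * tau ^+ K.-1.
  by rewrite deriv_scaled_pow hornerZ horner_exp hornerZ hornerX [r ^- 2 * s]mulrC.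
have q2 : q^`()^`().[s] = m * (K%:R * r ^- 2) * (K.-1%:R * r ^- 2) * tau ^+ K.-2.
  by rewrite !deriv_scaled_pow hornerZ horner_exp hornerZ hornerX [r ^- 2 * s]mulrC.
rewrite infinity_laplacian_radial -/s q1 q2 subr_ge0 => /(_ _)/wrap[].
  have n2 : \forall x \near y, sqdist Y x < r ^+ 2.
    by apply: near_sqball; rewrite -/s sE gtr_pMr// exprn_gt0.
  by rewrite /local_max; apply: filterS n2 => x /ltW; exact: ymax.
(* This form removes the truncated subtraction and shows that the exponent is positive. *)
have K3 : (3 * K - 2 = k * 3 + 4)%N by rewrite /K -(addn2 k) mulnDr -addnBA// mulnC.
have -> : 8 * (m * (K%:R / r ^+ 2) * tau ^+ K.-1) ^+ 3 * s +
   16 * (m * (K%:R / r ^+ 2) * tau ^+ K.-1) ^+ 2 *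
   (m * (K%:R / r ^+ 2) * (K.-1%:R / r ^+ 2) * tau ^+ K.-2) * s ^+ 2 =
   8 * K%:R ^+ 3 * (2 * K%:R - 1) * m ^+ 3 / r ^+ 4 * tau ^+ (3 * K - 2).
  rewrite sE K3 /K /= !exprS expr0 !mulr1 exprD exprM !exprS expr0 -!natr1; field.
  by rewrite gt_eqF.
(* The maximum may sit at [Y]; there the Laplacian of the barrier vanishes while the zeroth-order
   term is positive. *)
have [t0|t0] := eqVneq tau 0.
  rewrite t0 expr0n K3 addn4.
  by rewrite mulr0 leNgt pos_power_gt0.
have taugt0 : 0 < tau by rewrite lt_neqAle eq_sym t0.
apply/negP; rewrite -ltNge.
apply: (@lt_le_trans _ _ ((m * tau ^+ K) `^ gamma)); last first.
  apply: pos_power_ge => //; first by rewrite mulr_ge0 ?exprn_ge0// ltW.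
  by move: uqy; rewrite subr_gt0 qE => /ltW.
rewrite powRM ?exprn_ge0 ?(ltW m0)// -(powR_mulrn K tau0) -powRrM.
apply: (@lt_le_trans _ _ (m `^ gamma * tau ^+ (3 * K - 2))); last first.
  rewrite ler_pM2l ?powR_gt0// -(powR_mulrn _ tau0).
  by apply: ger_powR => //; rewrite taugt0 ltW.
rewrite ltr_pM2r ?exprn_gt0// ltr_pdivrMr ?exprn_gt0//.
by rewrite [ltRHS]mulrC.
Qed.

End pde.

(** * Porosity *)

Lemma open_positivity_set (R : realType) (n : nat) (Omega : set 'rV[R]_n)
    (u : 'rV[R]_n -> R) :
  open Omega -> {within Omega, continuous u} -> open (positivity_set Omega u).
Proof.
move=> oO cu; rewrite openE => x [Ox ux].
have /cvgr_gt/(_ _ ux) ux' := continuous_of_within oO cu Ox.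
have Ox' : \forall z \near x, Omega z by apply: open_nbhs_nbhs.
by apply: filterS2 Ox' ux' => z.
Qed.

Lemma frontier_disjoint (T : topologicalType) (A : set T) (x : T) :
  open A -> A x -> ~ frontier A x.
Proof. by move=> oA Ax [_]; apply; exact: (open_nbhs_nbhs (conj oA Ax)). Qed.

(** The requirement [K * gamma <= 3 * K - 2] reads [K >= 2 / (3 - gamma)]; [K] is this number plus
    2, so [K >= 2] as well and the second derivative of the barrier stays bounded at its centre. *)
Definition porosity_exponent (R : realType) (gamma : R) : nat :=
  (Num.truncn (2 / (3 - gamma))).

Lemma porosity_exponentP (R : realType) (gamma : R) : gamma < 3 ->
  (porosity_exponent gamma).+2%:R * gamma <=
    (3 * (porosity_exponent gamma).+2 - 2)%:R.
Proof.
move=> g3; set k := porosity_exponent gamma; have k2 : (2 <= 3 * k.+2)%N by rewrite mulnS.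
rewrite natrB// natrM.
suff : 2 <= k.+2%:R * (3 - gamma) by lra.
rewrite -ler_pdivrMr ?subr_gt0//.
have : 2 / (3 - gamma) < k.+1%:R by exact: truncnS_gt.
by move/ltW/le_trans; apply; rewrite ler_nat.
Qed.

(* [m ^ (3 - gamma)] is comparable to [r ^ 4], the scaling under which the
   equation is invariant: nondegeneracy produces a value [m] at distance [r],
   growth propagates positivity from it to a ball of comparable radius. *)
Lemma positivity_set_porous (R : realType) (n : nat) (gamma : R) :
  (0 < n)%N -> 0 <= gamma < 3 ->
  exists2 kappa : R, 0 < kappa < 1 &
  forall (Omega : set 'rV[R]_n) (u : 'rV[R]_n -> R), open Omega ->
    nonneg_bounded_solution gamma Omega u ->
    forall (x0 : 'rV[R]_n) (r : R), 0 < r -> (forall x, `|x - x0| <= r -> Omega x) ->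
    frontier (positivity_set Omega u) x0 ->
    exists x1, forall x, `|x - x1| <= kappa * r ->
      `|x - x0| <= r /\ positivity_set Omega u x.
Proof.
move=> n0 /andP[g0 g3].
have := porosity_exponentP g3; set k := porosity_exponent gamma => kP.
pose C : R := 8 * k.+2%:R ^+ 3 * (2 * k.+2%:R - 1).
have C1 : 1 <= C.
  have k1 : 1 <= k.+2%:R :> R by rewrite ler1n.
  have k3 : 1 <= k.+2%:R ^+ 3 :> R by rewrite exprn_ege1.
  by rewrite /C; nra.
have nR1 : 1 <= n%:R :> R by rewrite ler1n.
have Cn1 : 1 <= C * n%:R by nra.
have Cn0 : 0 < C * n%:R by apply: lt_le_trans Cn1.
(* Chosen so that [kappa * r = D / (2 * n)] with [D = rho / (16 * C)] and [rho = r / 4] below; a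
   max-norm ball of that radius lies in the Euclidean ball of radius [D / 2]. *)
exists (1 / (128 * (C * n%:R))).
  apply/andP; split; first by rewrite divr_gt0// mulr_gt0.
  by rewrite ltr_pdivrMr ?mulr_gt0//; lra.
move=> Omega u oO [cu u0 _ [sub sup]] x0 r r0 rO [+ _].
(* Three displacements of at most [rho] follow: from [x0] to [Y], from [Y] to [x1], and within the
   ball of radius [D] around [x1]. *)
pose rho := r / 4; have rho0 : 0 < rho by rewrite /rho; lra.
move=> /(_ _ (nbhsx_ballx x0 rho rho0)) [Y [[OY uY]]].
rewrite -ball_normE /= => x0Y.
(* The solution of [C * m ^ (3 - gamma) = rho ^ 4 / 2], half of the threshold for nondegeneracy. *)
pose m := (rho ^+ 4 / (2 * C)) `^ (3 - gamma)^-1.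
have C0 : 0 < C by exact: lt_le_trans C1.
have m0 : 0 < m by rewrite powR_gt0// divr_gt0// ?exprn_gt0// mulr_gt0.
have split3 (t : R) : 0 < t -> t ^+ 3 = t `^ gamma * t `^ (3 - gamma).
  move=> t0; rewrite -powRD; last by rewrite (gt_eqF t0) implybT.
  by rewrite addrC subrK powR_mulrn// ltW.
have mE : m `^ (3 - gamma) = rho ^+ 4 / (2 * C).
  rewrite /m -powRrM mulVf ?gt_eqF ?subr_gt0// powRr1//.
  by rewrite divr_ge0// ?exprn_ge0 ?ltW// mulr_gt0.
have inO x : `|x - x0| <= 3 * rho -> Omega x.
  by move=> H; apply: rO; apply: le_trans H _; rewrite /rho; lra.
have [||x1 x1Y ux1] := @subsolution_nondegenerate _ _ _ _ _ g0 oO Y rho m k sub rho0 _ uY m0 kP.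
- move=> x /(norm_le_of_sqdist (ltW rho0)) H; apply: inO.
  apply: le_trans (ler_distD Y _ _) _; rewrite [`|Y - _|]distrC; lra.
- rewrite -/C (split3 _ m0) mE mulrCA mulrC ltr_pM2r ?powR_gt0//.
  have -> : C * (rho ^+ 4 / (2 * C)) = rho ^+ 4 / 2 by field; rewrite gt_eqF//.
    have : 0 < rho ^+ 4 by exact: exprn_gt0.
    lra.
  by rewrite divr_gt0// ?exprn_gt0// mulr_gt0.
have {}x1Y := norm_le_of_sqdist (ltW rho0) x1Y.
have x10 : `|x1 - x0| <= 2 * rho.
  by apply: le_trans (ler_distD Y _ _) _; rewrite [`|Y - _|]distrC; lra.
have ux0 : 0 < u x1 by exact: lt_le_trans ux1.
(* Small enough that [8 * D ^ 4 < rho ^ 4 / (2 * C) = m ^ (3 - gamma)], the condition for growth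
   from [x1]. *)
pose D := rho / (16 * C).
have D0 : 0 < D by rewrite divr_gt0// mulr_gt0.
have Drho : D <= rho by rewrite ler_pdivrMr ?mulr_gt0// ler_pMr//; lra.
exists x1 => x xx1.
have xx1D : `|x - x1| <= D / 2 / n%:R.
  apply: le_trans xx1 _; rewrite le_eqVlt; apply/orP; left; apply/eqP.
  by rewrite /D /rho; field; rewrite !gt_eqF// (lt_le_trans _ nR1).
have xx1D' : `|x - x1| <= D.
  apply: le_trans xx1D _; rewrite ler_pdivrMr ?(lt_le_trans _ nR1)//.
  by apply: (@le_trans _ _ (D * 1)); [lra|rewrite ler_pM2l].
have xx0 : `|x - x0| <= 3 * rho.
  by apply: le_trans (ler_distD x1 _ _) _; lra.
split; first by apply: le_trans xx0 _; rewrite /rho; lra.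
split; first exact: inO.
apply: (@supersolution_growth _ _ _ _ _ g0 oO x1 x D sup) => //.
- move=> z /(norm_le_of_sqdist (ltW D0)) H; apply: inO.
  by apply: le_trans (ler_distD x1 _ _) _; lra.
- rewrite (split3 _ ux0) mulrC ltr_pM2l ?powR_gt0//.
  apply: (@lt_le_trans _ _ (m `^ (3 - gamma))); last first.
    apply: ge0_ler_powR; rewrite ?nnegrE ?subr_ge0 ?(ltW g3)//; exact: ltW.
  rewrite mE /D ltr_pdivlMr ?mulr_gt0//.
  have -> : 8 * (rho / (16 * C)) ^+ 4 * (2 * C) = rho ^+ 4 * ((16 * C) ^+ 3)^-1.
    by field; rewrite gt_eqF.
  rewrite gtr_pMr ?exprn_gt0// invf_lt1 ?exprn_gt0 ?mulr_gt0// exprn_egt1//; lra.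
- apply: le_trans (sqdist_le_of_norm xx1D) _.
  by rewrite mulrC divfK// gt_eqF// (lt_le_trans _ nR1).
Qed.

(** * Lebesgue measure of cubes *)

Lemma grid_count (R : realType) (x h alpha beta : R) (M : nat) :
  0 <= h -> alpha <= beta ->
  (\sum_(j < M) (alpha < x + j%:R * h < beta)%R%:R) * h <= beta - alpha + h.
Proof.
move=> h0 ab; set S := \sum_(j < M) _.
(* The induction also needs the first bound: when a new grid point lies below [beta], it turns the
   position of that point into a bound on the earlier count. *)
suff : S * h <= Num.max 0 (x + M%:R * h - alpha) /\ S * h <= beta - alpha + h by case.
rewrite {}/S; elim: M => [|M [IH1 IH2]].
  by rewrite big_ord0 mul0r; split; [rewrite le_max lexx|rewrite addr_ge0// subr_ge0].
rewrite big_ord_recr /=; set S := \sum_(j < M) _ in IH1 IH2 *.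
have mono : x + M%:R * h - alpha <= x + M.+1%:R * h - alpha.
  by rewrite -natr1 mulrDl mul1r; lra.
case: (boolP (alpha < x + M%:R * h < beta)) => [/andP[xa xb]|_] /=; last first.
  rewrite addr0; split => //; apply: le_trans IH1 _.
  by rewrite ge_max !le_max lexx /= mono orbT.
have E : Num.max 0 (x + M%:R * h - alpha) = x + M%:R * h - alpha.
  by apply/max_idPr; rewrite subr_ge0 ltW.
rewrite mulrDl mul1r; rewrite E in IH1; split; last lra.
by rewrite le_max; apply/orP; right; rewrite -natr1 mulrDl mul1r; lra.
Qed.

(** The indicator of a box is a product over the coordinates, so the sum over the grid factors into
    one-dimensional counts. *)
Lemma grid_box_count (R : realType) (n M : nat) (x : 'I_n -> R) (h : R)
    (alpha beta : 'I_n -> R) :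
  0 <= h -> (forall i, alpha i <= beta i) ->
  (\sum_(f : {ffun 'I_n -> 'I_M})
     [forall i, alpha i < x i + (f i)%:R * h < beta i]%:R) * h ^+ n <=
  \prod_(i < n) (beta i - alpha i + h).
Proof.
move=> h0 ab.
have -> : \sum_(f : {ffun 'I_n -> 'I_M})
     [forall i, alpha i < x i + (f i)%:R * h < beta i]%:R =
   \prod_(i < n) \sum_(j < M) (alpha i < x i + j%:R * h < beta i)%R%:R :> R.
  rewrite bigA_distr_bigA; apply: eq_bigr => f _.
  case: forallP => [H|/forallP/forallPn[i iN]]; first by rewrite big1// => i _; rewrite H.
  by rewrite (bigD1 i)//= (negbTE iN) mul0r.
rewrite -[in X in h ^+ X](card_ord n) -prodr_const -big_split /=.
apply: ler_prod => i _; rewrite grid_count// andbT mulr_ge0//.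
by apply: sumr_ge0 => j _; exact: ler0n.
Qed.

(** Two of the three [eta] open the box on both sides; the third absorbs the mesh of the grid. *)
Lemma prod_inflate (R : realType) (n : nat) (L : 'I_n -> R) (e : R) :
  0 < e -> exists2 eta : R, 0 < eta & \prod_(i < n) (L i + 3 * eta) <= \prod_(i < n) L i + e.
Proof.
move=> e0; pose f (t : R) := \prod_(i < n) (L i + 3 * t).
have cf : continuous f.
  rewrite /f; apply: continuous_big => [|i _ t]; first exact: mul_continuous.
  exact: (continuousD (@cst_continuous _ _ (L i) t)
    (continuousM (@cst_continuous _ _ (3 : R) t) (fun A H => H))).
have f0 : f 0 = \prod_(i < n) L i by apply: eq_bigr => i _; rewrite mulr0 addr0.
have /cvgr_le/(_ (f 0 + e)) := cf 0; rewrite ltrDl => /(_ e0).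
move=> /nbhs_ballP[d /= d0 H]; exists (d / 2); first by rewrite divr_gt0.
rewrite -f0; apply: H; rewrite -ball_normE /= sub0r normrN gtr0_norm; lra.
Qed.

Lemma pos_lower_bound (R : realType) (eta : nat -> R) (N : nat) :
  (forall k, 0 < eta k) -> exists2 d : R, 0 < d & forall k, (k < N)%N -> d <= eta k.
Proof.
move=> eta0; elim: N => [|N [d d0 H]]; first by exists 1.
exists (Num.min d (eta N)); first by rewrite lt_min d0 eta0.
move=> k; rewrite ltnS leq_eqVlt => /predU1P[->|kN]; first by rewrite ge_min lexx orbT.
by rewrite ge_min H.
Qed.

Lemma open_box_open (R : realType) (n : nat) (a b : 'I_n -> R) :
  open [set x : 'rV[R]_n | forall i, a i < x 0 i < b i].
Proof.
rewrite openE => x /= xab; rewrite /interior /=.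
apply: (@filter_forall _ _ _ (nbhs x)) => i.
have /andP[xa xb] := xab i.
have /cvgr_gt/(_ _ xa) h1 := @coord_continuous R 1 n 0 i x.
have /cvgr_lt/(_ _ xb) h2 := @coord_continuous R 1 n 0 i x.
by apply: filterS2 h1 h2 => z -> ->.
Qed.

Lemma sum_half_pow (R : realType) (e : R) (N : nat) : 0 <= e ->
  \sum_(k < N) e / 2 ^+ k.+1 <= e.
Proof.
move=> e0; suff -> : \sum_(k < N) e / 2 ^+ k.+1 = e - e / 2 ^+ N.
  by rewrite gerBl divr_ge0// exprn_ge0.
elim: N => [|N IH]; first by rewrite big_ord0 expr0 divr1 subrr.
by rewrite big_ord_recr /= IH exprS; field; rewrite expf_neq0.
Qed.

(* Compactness reduces to finitely many open boxes, whose volumes are compared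
   with that of the cube by counting points of a fine grid. *)
Lemma lebesgue_rV_cube_ge (R : realType) (n : nat) (a : 'rV[R]_n) (r : R)
    (A : set 'rV[R]_n) :
  0 < r -> [set x : 'rV[R]_n | forall i, a 0 i <= x 0 i <= a 0 i + r] `<=` A ->
  ((r ^+ n)%:E <= lebesgue_rV A)%E.
Proof.
move=> r0 QA; apply: le_ereal_inf_tmp => _ [ab [ab_le Aab] <-].
apply/lee_addgt0Pr => e e0.
pose vol k : R := \prod_(i < n) ((ab k).2 0 i - (ab k).1 0 i).
have vol0 k : 0 <= vol k by apply: prodr_ge0 => i _; rewrite subr_ge0.
have /choice[eta Heta] (k : nat) : exists eta : R, 0 < eta /\
    \prod_(i < n) ((ab k).2 0 i - (ab k).1 0 i + 3 * eta) <= vol k + e / 2 ^+ k.+1.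
  have [|eta ? ?] := @prod_inflate R n (fun i => (ab k).2 0 i - (ab k).1 0 i) (e / 2 ^+ k.+1).
    by rewrite divr_gt0// exprn_gt0.
  by exists eta.
pose O k := [set x : 'rV[R]_n | forall i,
  (ab k).1 0 i - eta k < x 0 i < (ab k).2 0 i + eta k].
pose Q := [set x : 'rV[R]_n | forall i, a 0 i <= x 0 i <= a 0 i + r].
have cQ : compact Q.
  have := @rV_compact R n (fun i => `[a 0 i, a 0 i + r]%classic)
    (fun i => @segment_compact R (a 0 i) (a 0 i + r)).
  congr compact; apply/seteqP; split => x /= H i; have := H i; by rewrite in_itv.
have : cover_compact Q by rewrite -compact_cover.
move=> /(_ nat setT O) [k _| x /QA/Aab[k _ xk]|J _ QJ]; first exact: open_box_open.
  exists k => // i; have /andP[h1 h2] := xk i; have [? _] := Heta k.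
  by apply/andP; split; lra.
pose N := (\max_(k <- finmap.enum_fset J) k).+1.
have QN x : Q x -> exists k : 'I_N, O k x.
  move=> /QJ[k /= kJ xk].
  have kN : (k < N)%N by rewrite ltnS; exact: (@leq_bigmax_seq _ _ xpredT id).
  by exists (Ordinal kN).
have [d d0 dN] := @pos_lower_bound R eta N (fun k => (Heta k).1).
pose M := (Num.truncn (r / d)).+1; pose h := r / M%:R.
have M0 : 0 < M%:R :> R by rewrite ltr0n.
have h0 : 0 < h by rewrite divr_gt0.
have hd : h <= d.
  by rewrite ler_pdivrMr// mulrC -ler_pdivrMr// ltW// truncnS_gt.
pose chi (k : 'I_N) (f : {ffun 'I_n -> 'I_M}) :=
  [forall i, (ab k).1 0 i - eta k < a 0 i + (f i)%:R * h < (ab k).2 0 i + eta k].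
(* Each of the [M ^ n] grid points lies in the cube, hence in one of these boxes. *)
have count1 : (M ^ n)%:R <= \sum_(k < N) \sum_f (chi k f)%:R :> R.
  have -> : (M ^ n)%:R = \sum_(f : {ffun 'I_n -> 'I_M}) (1 : R).
    by rewrite sumr_const card_ffun !card_ord.
  rewrite exchange_big /=; apply: ler_sum => f _.
  have [k kO] : exists k : 'I_N, O k (\row_i (a 0 i + (f i)%:R * h)).
    apply: QN => i; rewrite mxE lerDl mulr_ge0 ?(ltW h0)//= lerD2l /h mulrA.
    by rewrite ler_pdivrMr// mulrC ler_pM2l// ler_nat ltnW.
  rewrite (bigD1 k)//= (_ : chi k f).
    by rewrite lerDl; apply: sumr_ge0 => j _; exact: ler0n.
  by apply/forallP => i; have := kO i; rewrite mxE.
have bound : r ^+ n <= \sum_(k < N) (vol k + e / 2 ^+ k.+1).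
  have -> : r = M%:R * h by rewrite /h mulrC divfK// gt_eqF.
  rewrite exprMn -natrX.
  apply: (le_trans (ler_wpM2r (exprn_ge0 _ (ltW h0)) count1)).
  rewrite mulr_suml; apply: ler_sum => k _.
  have [eta0 He] := Heta k; apply: le_trans He.
  apply: le_trans (grid_box_count _ _ _ _) _; first exact: ltW.
    by move=> i; have := ab_le k i; lra.
  apply: ler_prod => i _; have := ab_le k i; have := dN k (ltn_ord k).
  by move=> ? ?; apply/andP; split; lra.
rewrite big_split /= in bound.
have bound' : r ^+ n <= \sum_(k < N) vol k + e.
  by apply: le_trans bound _; rewrite lerD2l sum_half_pow// ltW.
apply: (@le_trans _ _ ((\sum_(k < N) vol k + e)%:E)); first by rewrite lee_fin.
rewrite EFinD leeD2r//.
have := @nneseries_lim_ge R (fun k => (vol k)%:E) xpredT 0 N (fun k _ _ => vol0 k).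
by rewrite big_mkord sumEFin.
Qed.

(** * Hausdorff measure of porous sets *)

Section cubes.
Context (R : realType) (n : nat).

Definition cube (a : 'rV[R]_n) (l : R) : set 'rV[R]_n :=
  [set x | forall i, a 0 i <= x 0 i <= a 0 i + l].

Definition subcube_corner (N : nat) (l : R) (a : 'rV[R]_n)
    (f : {ffun 'I_n -> 'I_N}) : 'rV[R]_n :=
  \row_i (a 0 i + (f i)%:R * (l / N%:R)).

Lemma cube_subdivision (N : nat) (l : R) (a x : 'rV[R]_n) :
  (0 < N)%N -> 0 < l -> cube a l x ->
  exists f : {ffun 'I_n -> 'I_N}, cube (subcube_corner l a f) (l / N%:R) x.
Proof.
case: N => // N _ l0 xa; set h := l / N.+1%:R.
have h0 : 0 < h by rewrite divr_gt0.
have hl : N.+1%:R * h = l by rewrite /h mulrC divfK.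
pose t i := Num.truncn ((x 0 i - a 0 i) / h).
(* On the far face the truncation is one too large; the minimum puts such points in the last
   subcube. *)
exists [ffun i => inord (minn (t i) N)] => i; rewrite mxE ffunE inordK ?ltnS ?geq_minr//.
have /andP[x1 x2] := xa i.
have /truncn_itv/andP[t1 t2] : 0 <= (x 0 i - a 0 i) / h.
  by rewrite divr_ge0 ?subr_ge0// ltW.
rewrite ler_pdivlMr// -/(t i) in t1; rewrite ltr_pdivrMr// -/(t i) in t2.
rewrite -natr1 mulrDl mul1r in t2; rewrite -natr1 mulrDl mul1r in hl.
case: (leqP (t i) N) => tN.
  by rewrite -/h; apply/andP; split; lra.
have : N%:R * h + h <= (t i)%:R * h.
  by rewrite -[X in _ + X]mul1r -mulrDl natr1 ler_pM2r// ler_nat.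
by rewrite -/h => ?; apply/andP; split; lra.
Qed.

Lemma diam_cube_le (a : 'rV[R]_n) (l : R) : 0 <= l ->
  (diam (cube a l) <= (n%:R * l)%:E)%E.
Proof.
move=> l0; apply: ge_ereal_sup => _ [[x y] [/= xa ya] <-]; rewrite lee_fin.
rewrite /enorm -[leRHS]ger0_norm ?mulr_ge0// -sqrtr_sqr ler_wsqrtr//.
have <- : sqdist y x = \sum_(i < n) (x - y) 0 i ^+ 2.
  by apply: eq_bigr => i _; rewrite !mxE.
apply: sqdist_le_of_norm; apply: normv_le => // i; rewrite !mxE.
have /andP[? ?] := xa i; have /andP[? ?] := ya i.
by rewrite ler_norml; apply/andP; split; lra.
Qed.

Lemma hausdorff_gauge_cube_le (s : R) (a : 'rV[R]_n) (l : R) : 0 <= s -> 0 <= l ->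
  (hausdorff_gauge s (cube a l) <= ((n%:R * l) `^ s)%:E)%E.
Proof.
move=> s0 l0; rewrite /hausdorff_gauge; case: ifPn => [_|ne].
  by rewrite lee_fin powR_ge0.
rewrite -poweR_EFin; apply: gt0_ler_poweR => //; last exact: diam_cube_le.
  rewrite in_itv /= leey andbT; apply: ereal_sup_ubound.
  exists (a, a) => /=; last by rewrite subrr /enorm big1 ?sqrtr0// => i _; rewrite mxE expr0n.
  by split => i /=; rewrite lexx lerDl.
by rewrite in_itv /= leey andbT lee_fin mulr_ge0.
Qed.

(* If the concentric cube of side [l / 4] misses [F], its centre is the hole;
   otherwise porosity at one of its points gives a hole inside the cube. *)
Lemma porous_cube (F : set 'rV[R]_n) (kappa r0 : R) (N : nat) (a : 'rV[R]_n) (l : R) :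
  0 < kappa < 1 ->
  (forall x0 r, F x0 -> 0 < r < r0 ->
     exists x1, forall x, `|x - x1| <= kappa * r -> `|x - x0| <= r /\ ~ F x) ->
  8 <= kappa * N%:R -> 0 < l < r0 ->
  exists f : {ffun 'I_n -> 'I_N},
    forall x, cube (subcube_corner l a f) (l / N%:R) x -> ~ F x.
Proof.
move=> /andP[k0 k1] porous kN /andP[l0 lr0].
have N0 : (0 < N)%N.
  by rewrite lt0n; apply/eqP => N0; move: kN; rewrite N0 mulr0; lra.
have NR0 : 0 < N%:R :> R by rewrite ltr0n.
pose c : 'rV[R]_n := \row_i (a 0 i + l / 2).
have [x1 [x1c x1F]] : exists x1, `|x1 - c| <= 3 / 8 * l /\
    forall x, `|x - x1| <= kappa * (l / 8) -> ~ F x.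
  (* Porosity at scale [l / 4] puts the hole's centre within [l / 8 + l / 4] of [c], hence inside
     the cube. *)
  have [[x0 [Fx0 x0c]]|noF] := pselect (exists x0, F x0 /\ `|x0 - c| <= l / 8).
    have [|x1 Hx1] := porous x0 (l / 4) Fx0.
      by apply/andP; split; lra.
    exists x1; split.
      apply: le_trans (ler_distD x0 _ _) _.
      have [|? _] := Hx1 x1; first by rewrite subrr normr0 mulr_ge0 ?(ltW k0)//; lra.
      lra.
    move=> x xx1; have [|//] := Hx1 x; apply: le_trans xx1 _.
    by rewrite ler_pM2l//; lra.
  exists c; split; first by rewrite subrr normr0; lra.
  move=> x xc Fx; apply: noF; exists x; split => //; apply: le_trans xc _.
  by rewrite ler_piMl ?(ltW k1)//; lra.
(* A subcube containing [x1] has side [l / N <= kappa * l / 8], so it lies in the hole. *)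
have [|f fx1] := @cube_subdivision N l a x1 N0 l0.
  move=> i; have := normv_coord (x1 - c) i; rewrite !mxE ler_norml => /andP[? ?].
  by apply/andP; split; lra.
exists f => x fx; apply: x1F; apply: (@le_trans _ _ (l / N%:R)).
  apply: normv_le => [|i]; first by rewrite divr_ge0// ltW.
  have /andP[? ?] := fx1 i; have /andP[? ?] := fx i.
  by rewrite !mxE ler_norml; apply/andP; split; lra.
rewrite ler_pdivrMr//.
have -> : kappa * (l / 8) * N%:R = l * (kappa * N%:R / 8) by ring.
by rewrite ler_pMr//; lra.
Qed.

Lemma porous_covering (F : set 'rV[R]_n) (kappa r0 : R) (N : nat) (L : R) :
  0 < kappa < 1 -> 0 < r0 ->
  (forall x0 r, F x0 -> 0 < r < r0 ->
     exists x1, forall x, `|x - x1| <= kappa * r -> `|x - x0| <= r /\ ~ F x) ->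
  (forall x, F x -> `|x| <= L) ->
  8 <= kappa * N%:R ->
  exists (C : nat) (l : R), 0 < l /\ forall j, exists S : seq 'rV[R]_n,
    (size S <= C * (N ^ n).-1 ^ j)%N /\
    forall x, F x -> exists2 b, b \in S & cube b (l / N%:R ^+ j) x.
Proof.
move=> /[dup] k01 /andP[k0 k1] r00 porous FL kN.
have N0 : (0 < N)%N.
  by rewrite lt0n; apply/eqP => N0; move: kN; rewrite N0 mulr0; lra.
have N1 : 1 <= N%:R :> R by rewrite ler1n.
pose L' := `|L| + 1; have L'0 : 0 < L' by rewrite ltr_wpDl.
(* The initial cubes have side below [r0], so porosity applies at every later scale. *)
pose m := (Num.truncn (2 * L' / r0)).+1.
have m0 : 0 < m%:R :> R by rewrite ltr0n.
pose l := 2 * L' / m%:R.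
have l0 : 0 < l by rewrite divr_gt0// mulr_gt0.
have lr0 : l < r0.
  by rewrite ltr_pdivrMr// [r0 * _]mulrC -ltr_pdivrMr// truncnS_gt.
exists (m ^ n)%N, l; split => //; elim => [|j [S [sizeS HS]]].
  pose a0 : 'rV[R]_n := const_mx (- L').
  exists [seq subcube_corner (2 * L') a0 f | f <- enum {ffun 'I_n -> 'I_m}]; split.
    by rewrite size_map -cardE card_ffun !card_ord muln1.
  move=> x Fx; have [| | |f fx] := @cube_subdivision m (2 * L') a0 x => //.
    by rewrite mulr_gt0.
    move=> i; have := le_trans (normv_coord x i) (FL x Fx); rewrite mxE.
    rewrite ler_norml => /andP[? ?]; have := ler_norm L; rewrite /L'.
    by move=> ?; apply/andP; split; lra.
  by exists (subcube_corner (2 * L') a0 f); [rewrite map_f// mem_enum|rewrite expr0 divr1].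
set lj := l / N%:R ^+ j in HS.
have lj0 : 0 < lj by rewrite divr_gt0// exprn_gt0// ltr0n.
have ljr0 : lj < r0.
  by apply: le_lt_trans lr0; rewrite ler_piMr ?(ltW l0)// invf_le1 ?exprn_ege1// exprn_gt0// ltr0n.
(* The subcube of index [g b] misses [F] and is dropped from the next generation. *)
have /choice[g Hg] (b : 'rV[R]_n) : exists f : {ffun 'I_n -> 'I_N},
    forall x, cube (subcube_corner lj b f) (lj / N%:R) x -> ~ F x.
  by apply: (porous_cube b k01 porous kN); rewrite lj0.
exists [seq subcube_corner lj b f | b <- S, f <- enum (predC1 (g b))]; split.
  rewrite size_allpairs_dep.
  have -> : [seq size (enum (predC1 (g b))) | b <- S] = [seq (N ^ n).-1 | b <- S].
    by apply: eq_map => b; rewrite -cardE cardC1 card_ffun !card_ord.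
  have -> (T : Type) (q : nat) (s : seq T) : sumn [seq q | _ <- s] = (size s * q)%N.
    by elim: s => //= _ s ->; rewrite mulSn.
  by rewrite expnSr mulnA leq_mul2r sizeS orbT.
move=> x Fx; have [b bS bx] := HS x Fx.
have [f fx] := @cube_subdivision N lj b x N0 lj0 bx.
exists (subcube_corner lj b f).
  apply/allpairsPdep; exists b, f; split => //; rewrite mem_enum inE.
  by apply/eqP => fg; apply: (Hg b x) => //; rewrite -fg.
by rewrite exprSr invfM mulrA.
Qed.

Lemma hausdorff_content_cover_le (s delta l : R) (F : set 'rV[R]_n)
    (S : seq 'rV[R]_n) : 0 <= s -> 0 <= l -> n%:R * l <= delta ->
  (forall x, F x -> exists2 b, b \in S & cube b l x) ->
  (hausdorff_content s delta F <= ((size S)%:R * (n%:R * l) `^ s)%:E)%E.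
Proof.
move=> s0 l0 nl HS.
(* Padding by empty sets costs nothing: their gauge is 0 and their diameter is -oo. *)
pose U (k : nat) := if (k < size S)%N then cube (nth 0 S k) l else set0.
have gauge0 : hausdorff_gauge s (set0 : set 'rV[R]_n) = 0%E by rewrite /hausdorff_gauge eqxx.
apply: (@le_trans _ _ (\sum_(k <oo) hausdorff_gauge s (U k))%E).
  apply: ereal_inf_lbound; exists U => //; split.
    move=> k; rewrite /U; case: ifPn => _.
      by apply: le_trans (diam_cube_le _ l0) _; rewrite lee_fin.
    by rewrite /diam set0X image_set0 ereal_sup0 leNye.
  move=> x /HS[b bS bx]; exists (index b S) => //.
  by rewrite /U index_mem bS nth_index.
rewrite (@nneseries_split R _ 0 (size S)) => [|k _]; last first.
  by rewrite /hausdorff_gauge; case: ifPn => // _; exact: poweR_ge0.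
rewrite add0n [X in (_ + X)%E]eseries0 ?adde0 => [|k Sk _]; last first.
  by rewrite /U ltnNge Sk.
rewrite big_mkord mulr_natl -[X in _ *+ X](card_ord (size S)) -sumr_const -sumEFin.
apply: lee_sum => k _; rewrite /U ltn_ord; exact: hausdorff_gauge_cube_le.
Qed.

(** With [N ^ s = N ^ n - 1], the growth in the number of cubes cancels the decay of their gauges,
    and each generation has total gauge at most [C * (n * l) ^ s]. *)
Lemma porous_hausdorff_finite (F : set 'rV[R]_n) (kappa r0 : R) (N : nat) (L s : R) :
  0 < kappa < 1 -> 0 < r0 ->
  (forall x0 r, F x0 -> 0 < r < r0 ->
     exists x1, forall x, `|x - x1| <= kappa * r -> `|x - x0| <= r /\ ~ F x) ->
  (forall x, F x -> `|x| <= L) ->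
  8 <= kappa * N%:R -> 0 <= s -> N%:R `^ s = ((N ^ n).-1)%:R ->
  (hausdorff_measure s F < +oo)%E.
Proof.
move=> k01 r00 porous FL kN s0 Ns.
have [C [l [l0 H]]] := porous_covering k01 r00 porous FL kN.
have N2 : 2 <= N%:R :> R.
  move: k01 => /andP[k0 k1]; rewrite ler_nat ltnNge; apply/negP => N1.
  have : N%:R <= 1 :> R by rewrite (ler_nat _ _ 1).
  have : 0 <= N%:R :> R by rewrite ler0n.
  by nra.
have N0 : 0 < N%:R :> R by lra.
apply: (@le_lt_trans _ _ (C%:R * (n%:R * l) `^ s)%:E); last exact: ltry.
apply: ge_ereal_sup => _ [delta delta0 <-].
(* The crude bound [j <= 2 ^ j <= N ^ j] suffices to bring the diameters below [delta]. *)
pose j := (Num.truncn (n%:R * l / delta)).+1.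
have jd : n%:R * (l / N%:R ^+ j) <= delta.
  rewrite mulrA ler_pdivrMr ?exprn_gt0// [delta * _]mulrC -ler_pdivrMr//.
  apply: (@le_trans _ _ j%:R); first by rewrite ltW// truncnS_gt.
  apply: (@le_trans _ _ (2 ^+ j)); last by rewrite lerXn2r ?nnegrE//; lra.
  by rewrite -natrX ler_nat ltnW// ltn_expl.
have [S [sizeS HS]] := H j.
have lj0 : 0 <= l / N%:R ^+ j by rewrite divr_ge0 ?exprn_ge0 ?ltW.
apply: le_trans (hausdorff_content_cover_le s0 lj0 jd HS) _; rewrite lee_fin.
rewrite mulrA powRM ?mulr_ge0 ?(ltW l0) ?invr_ge0 ?exprn_ge0 ?(ltW N0)//.
have -> : (N%:R ^- j) `^ s = ((((N ^ n).-1)%:R) ^+ j)^-1 :> R.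
  by rewrite -powR_invn ?(ltW N0)// -powRrM mulrC powRrM Ns powR_invn.
rewrite mulrCA [leRHS]mulrC; apply: ler_wpM2l; first exact: powR_ge0.
rewrite ler_pdivrMr; last by rewrite exprn_gt0// -Ns powR_gt0.
by rewrite -natrX -natrM ler_nat.
Qed.

End cubes.

(** * Uniform radii, the exponent, and the two estimates *)

(** This radius depends only on the two sets, so the range of admissible [r] is the same for all
    solutions [u]. *)
Lemma compact_inner_radius (R : realType) (n : nat) (K Omega : set 'rV[R]_n) :
  compact K -> open Omega -> K `<=` Omega ->
  exists2 r0 : R, 0 < r0 & forall x, K x -> forall y, `|y - x| < r0 -> Omega y.
Proof.
move=> /compact_near_coveringP cK oO KO.
have := cK R (0^'+) (fun r x => forall y, `|y - x| < r -> Omega y) _.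
case=> [x Kx|].
  have /nbhs_ballP[e /= e0 He] := open_nbhs_nbhs (conj oO (KO _ Kx)).
  exists (ball x (e / 2), [set r | r < e / 2]) => /=.
    split; first by apply: nbhsx_ballx; rewrite divr_gt0.
    by apply: nbhs_right_lt; rewrite divr_gt0.
  move=> [z r] /= [+ re] y yz; rewrite -ball_normE /= => xz; apply: He.
  rewrite -ball_normE /=; apply: le_lt_trans (ler_distD z _ _) _.
  by rewrite [`|z - y|]distrC; lra.
move=> e /= e0 He; exists (e / 2); first by rewrite divr_gt0.
move=> x Kx; apply: (He (e / 2)) => //=; last by rewrite divr_gt0.
by rewrite sub0r normrN gtr0_norm ?divr_gt0//; lra.
Qed.

Lemma enorm_lt_of_norm (R : realType) (n : nat) (x0 x : 'rV[R]_n) (r : R) :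
  (0 < n)%N -> 0 < r -> `|x - x0| <= r / (2 * n%:R) -> eball x0 r x.
Proof.
move=> n0 r0 /sqdist_le_of_norm H; rewrite /eball /= /enorm.
have -> : \sum_(i < n) (x - x0) 0 i ^+ 2 = sqdist x0 x.
  by apply: eq_bigr => i _; rewrite !mxE.
have nE : n%:R * (r / (2 * n%:R)) = r / 2 by field; rewrite pnatr_eq0 -lt0n.
apply: (@le_lt_trans _ _ (Num.sqrt ((r / 2) ^+ 2))).
  by rewrite ler_wsqrtr// -nE.
by rewrite sqrtr_sqr gtr0_norm ?divr_gt0//; lra.
Qed.

(** The exponent [n - sigma] is [ln p / ln N] with [p = N ^ n - 1]; then [p < N ^ n] gives
    [sigma > 0] and [p >= N ^ (n - 1)] gives [sigma <= 1]. *)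
Lemma porosity_dimension (R : realType) (n N : nat) : (2 <= n)%N -> (2 <= N)%N ->
  exists2 sigma : R, 0 < sigma <= 1 &
    0 <= n%:R - sigma /\ N%:R `^ (n%:R - sigma) = ((N ^ n).-1)%:R.
Proof.
move=> n2 N2; set p := (N ^ n).-1.
have n1E : n = n.-1.+1 by rewrite prednK// (leq_trans _ n2).
have Nn0 : (0 < N ^ n)%N by rewrite expn_gt0 (leq_trans _ N2).
have pN : p.+1 = (N ^ n)%N by rewrite prednK.
have Np : (N ^ n.-1 <= p)%N.
  rewrite -ltnS pN ltn_exp2l//; first by rewrite [ltnRHS]n1E.
have p0 : (0 < p)%N by apply: leq_trans Np; rewrite expn_gt0 (leq_trans _ N2).
have N0 : 0 < N%:R :> R by rewrite ltr0n (leq_trans _ N2).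
have lnN : 0 < ln (N%:R : R) by rewrite ln_gt0// ltr1n.
have ln_pow (k : nat) : ln ((N ^ k)%:R : R) = k%:R * ln N%:R.
  by rewrite natrX lnXn// mulr_natl.
exists (n%:R - ln p%:R / ln N%:R).
  rewrite subr_gt0 ltr_pdivrMr// -ln_pow ltr_ln ?posrE ?ltr0n// ltr_nat -pN ltnSn /=.
  have : (n.-1)%:R * ln N%:R <= ln p%:R :> R.
    by rewrite -ln_pow ler_ln ?posrE ?ltr0n ?expn_gt0 ?(leq_trans _ N2)// ler_nat.
  rewrite -ler_pdivlMr// => H.
  have : n%:R = (n.-1)%:R + 1 :> R by rewrite natr1 -n1E.
  lra.
rewrite opprB addrC subrK; split.
  by rewrite divr_ge0 ?(ltW lnN)// ln_ge0// ler1n.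
by rewrite /powR gt_eqF// divfK ?gt_eqF// lnK// posrE ltr0n.
Qed.

Theorem corollary6p2 (R : realType) (n : nat) (gamma : R)
    (hn : (2 <= n)%N) (hgamma : 0 <= gamma < 3) :
  (forall Omega Omega' : set 'rV[R]_n,
     domain Omega -> bounded_set Omega ->
     domain Omega' -> compactly_contained Omega' Omega ->
     forall M : R,
     exists2 iota : R, 0 < iota &
     exists2 r0 : R, 0 < r0 &
     forall u : 'rV[R]_n -> R,
       nonneg_bounded_solution gamma Omega u ->
       Linfty_norm Omega u = M%:E ->
       forall X0 : 'rV[R]_n,
         (frontier (positivity_set Omega u) `&` Omega') X0 ->
         forall r : R, 0 < r < r0 ->
           (iota%:E <=
             lebesgue_rV (eball X0 r `&` positivity_set Omega u)
               * (r ^- n)%:E)%E)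
  /\
  (exists2 sigma0 : R, 0 < sigma0 <= 1 &
     forall Omega : set 'rV[R]_n,
       domain Omega -> bounded_set Omega ->
     forall u : 'rV[R]_n -> R,
       nonneg_bounded_solution gamma Omega u ->
       forall K : set 'rV[R]_n, compact K -> K `<=` Omega ->
         (hausdorff_measure (n%:R - sigma0)
            (frontier (positivity_set Omega u) `&` K) < +oo)%E).
Proof.
have n0 : (0 < n)%N by exact: leq_trans hn.
have nR0 : 0 < n%:R :> R by rewrite ltr0n.
have [kappa /andP[k0 k1] porous] := positivity_set_porous n0 hgamma.
split.
  move=> Omega Omega' [oO _ _] _ _ [cO' O'O] M.
  have [r1 r10 Hr1] := compact_inner_radius cO' oO O'O.
  (* The volume, divided by [r ^ n], of a cube of side [kappa * rho] with [rho = r / (2 * n)]; the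
     max-norm ball of radius [rho] lies in the Euclidean ball of radius [r]. *)
  exists ((kappa / (2 * n%:R)) ^+ n).
    by rewrite exprn_gt0// divr_gt0// mulr_gt0.
  exists r1 => // u su _ X0 [FX0 OX0] r /andP[r0 rr1].
  pose rho := r / (2 * n%:R).
  have n2 : 1 <= 2 * n%:R :> R by have : 1 <= n%:R :> R; [rewrite ler1n|lra].
  have rho0 : 0 < rho by rewrite divr_gt0// (lt_le_trans _ n2).
  have rhor : rho <= r.
    by rewrite ler_pdivrMr ?(lt_le_trans _ n2)// ler_pMr.
  have [|x1 Hx1] := porous Omega u oO su X0 rho rho0 _ FX0.
    move=> x xX0; apply: (Hr1 X0) => //; first exact: subset_closure.
    by apply: le_lt_trans xX0 _; apply: le_lt_trans rr1.
  have kr0 : 0 < kappa * rho by rewrite mulr_gt0.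
  have leb : (((kappa * rho) ^+ n)%:E <=
      lebesgue_rV (eball X0 r `&` positivity_set Omega u))%E.
    (* The cube with corner [x1], one orthant of the hole, is enough. *)
    apply: (lebesgue_rV_cube_ge kr0 (a := x1)) => x /= xQ.
    have [|xX0 Px] := Hx1 x.
      apply: normv_le => [|i]; first exact: ltW.
      have /andP[? ?] := xQ i.
      by rewrite !mxE ler_norml; apply/andP; split; lra.
    by split => //; exact: enorm_lt_of_norm.
  have rn0 : (0 <= (r ^- n)%:E)%E by rewrite lee_fin invr_ge0 exprn_ge0// ltW.
  apply: le_trans (lee_wpmul2r rn0 leb); rewrite -EFinM lee_fin.
  have -> : kappa * rho = kappa / (2 * n%:R) * r by rewrite /rho; ring.
  by rewrite [X in _ <= X * _]exprMn mulfK// gt_eqF// exprn_gt0.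
(* [N] comes from [kappa] alone, so [sigma0] depends only on [n] and [gamma]. *)
pose N := (Num.truncn (8 / kappa)).+1.
have kN : 8 <= kappa * N%:R.
  by rewrite mulrC -ler_pdivrMr// ltW// truncnS_gt.
have N2 : (2 <= N)%N.
  rewrite ltnNge; apply/negP => N1.
  have : N%:R <= 1 :> R by rewrite (ler_nat _ _ 1).
  have : 0 <= N%:R :> R by rewrite ler0n.
  by nra.
have [sigma0 sigma01 [s0 Ns]] := porosity_dimension R hn N2.
exists sigma0 => // Omega [oO _ _] _ u su K cK KO.
have [r1 r10 Hr1] := compact_inner_radius cK oO KO.
have [L [_ HL]] := compact_bounded cK.
have k01 : 0 < kappa < 1 by rewrite k0.
(* Holes of positivity are holes of the free boundary, as the open set [{u > 0}] does not meet its
   own frontier. *)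
apply: (porous_hausdorff_finite (L := L + 1) k01 r10 _ _ kN s0 Ns); last first.
  by move=> x [_ Kx]; apply: (HL (L + 1)) => //; rewrite ltrDl.
move=> x0 r [Fx0 Kx0] /andP[r0 rr1].
have [|x1 Hx1] := porous Omega u oO su x0 r r0 _ Fx0.
  by move=> x xx0; apply: (Hr1 x0) => //; exact: le_lt_trans rr1.
exists x1 => x /Hx1[xx0 Px]; split => // -[+ _].
have [cu _ _ _] := su.
exact: frontier_disjoint (open_positivity_set oO cu) Px.
Qed.
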